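(* Let $\alpha>\beta>\gamma>0$ and $0<\delta<\pi$, and let $\mathbf r:U\cup U^*\to\mathbb R^3$ be a discrete ellipsoid of type $(\alpha,\beta,\gamma,\delta)$ (as defined in the context). Then: (i) The parameter polygons $\frac{n_1\pm n_2}{2}=\mathrm{const}$ are discrete circles, which lie in parallel planes (for each of the two choices of sign, the polygons of that family lie in mutually parallel planes). (ii) The planes $\Box(n_1,n_2)$ along any of the circular cross sections $\frac{n_1\pm n_2}{2}=\mathrm{const}$ meet at a point. (iii) The collection of discrete circles forms two binets which are diagonal to the principal binet $\mathbf r$. (iv) The two families of discrete circular cross sections may be continuously deformed in such a manner that the deformed discrete circles are congruent to the original discrete circles and remain the discrete circular cross sections of discrete ellipsoids. Furthermore, any two discrete ellipsoids from this family of deformations are discrete confocal quadrics up to a scaling.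
   Context: Notation: $(\mathbb Z^2)^*=(\mathbb Z+\frac12)^2$, $n^\pm=n\pm\frac12$, and for a real function $f$ of a variable $n\in\frac12\mathbb Z$ the discrete square is $f^{\mathbb 2}(n)=f(n)f(n+\frac12)$. A binet is a map $\mathbf r:U\cup U^*\to\mathbb R^3$ with $U\subset\mathbb Z^2$, $U^*\subset(\mathbb Z^2)^*$. It is principal if all elementary quadrilaterals $(\mathbf r(n_1^-,n_2^-),\mathbf r(n_1^+,n_2^-),\mathbf r(n_1^+,n_2^+),\mathbf r(n_1^-,n_2^+))$ are planar, the corresponding plane being denoted $\Box(n_1,n_2)$, and all pairs of dual edges $(\mathbf r(n_1^-,n_2),\mathbf r(n_1^+,n_2))$ and $(\mathbf r(n_1,n_2^-),\mathbf r(n_1,n_2^+))$ are orthogonal. Discrete ellipsoid of type $(\alpha,\beta,\gamma,\delta)$: a binet $\mathbf r=(x,y,z)$ of the form $$x=\tfrac{1}{\cos(\delta/2)}\sqrt{\tfrac{\alpha(\alpha-\gamma)}{\alpha-\beta}}\sin(\delta n_1)\cos(\delta n_2),\quad y=\sqrt{\tfrac{\beta}{(\alpha-\beta)(\beta-\gamma)}}\,g_1(n_1)g_2(n_2),\quad z=\tfrac{1}{\cos(\delta/2)}\sqrt{\tfrac{\gamma(\alpha-\gamma)}{\beta-\gamma}}\cos(\delta n_1)\sin(\delta n_2),$$ where, with $f_1(n)=\sqrt{\frac{\alpha-\gamma}{\cos(\delta/2)}}\sin(\delta n)$ and $f_2(n)=\sqrt{\frac{\alpha-\gamma}{\cos(\delta/2)}}\cos(\delta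 n)$, the functions $g_1,g_2$ are determined by initial conditions and the recurrence relations $g_1(n_1^+)=\frac{\alpha-\beta-f_1^{\mathbb 2}(n_1)}{g_1(n_1)}$, $g_2(n_2^+)=\frac{f_2^{\mathbb 2}(n_2)-\alpha+\beta}{g_2(n_2)}$. Such a binet is a principal binet. Discrete coordinates: $n_\pm=\frac{n_1\pm n_2}{2}$. The parameter polygon $n_+=\mathrm{const}$ is the discrete curve indexed by $n_-$ (consecutive points have indices $(n_1,n_2)$ and $(n_1+\frac12,n_2-\frac12)$); similarly $n_-=\mathrm{const}$ is indexed by $n_+$ (consecutive indices $(n_1,n_2)$, $(n_1+\frac12,n_2+\frac12)$). These polygons are the discrete circular cross sections of the discrete ellipsoid. The planes along such a polygon are the planes $\Box(n_1,n_2)$ with $(n_1,n_2)$ running through its indices. Discrete circle: a planar discrete curve $n\mapsto\mathbf r(n)$, with $n$ in a subset of $\mathbb Z\cup(\mathbb Z+\frac12)$, for which there exist a centre and a radius $R>0$ in its plane such that each vertex $\mathbf r(n)$ is the pole of the line through $\mathbf r(n^-)$ and $\mathbf r(n^+)$ with respect to the circle with this centre and radius; algebraically, in Cartesian coordinates $(X,Y)$ of the plane with centre $(X_0,Y_0)$: $(X(n)-X_0)(X(n^+)-X_0)+(Y(n)-Y_0)(Y(n^+)-Y_0)=R^2$. Diagonal binets: for a binet $\mathbf r$ on $U\cup U^*$, consider the map $(n_+,n_-)\mapsto\mathbf r(n_++n_-,n_+-n_-)$ on $\{(n_+,n_-)\in(\frac12\mathbb Z)^2:(n_++n_-,n_+-n_-)\in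 U\cup U^*\}$; it consists of a pair of binets, one coming from $U$ (defined on a subset of $\mathbb Z^2\cup(\mathbb Z^2)^*$) and one from $U^*$ (defined on a subset of the remaining points of $(\frac12\mathbb Z)^2$), and this pair is called diagonal to $\mathbf r$. Deformation in (iv): a continuous one-parameter family of discrete ellipsoids containing $\mathbf r$ such that, for any two members, corresponding discrete circles (same sign, same constant) are congruent. Discrete confocal quadrics: a discrete confocal system with constants $a>b>c$, continuous in the parameter $s$ labelling the discrete ellipsoids, is a map $$\hat{\mathbf r}(n_1,n_2,s)=\left(\tfrac{f_1(n_1)f_2(n_2)f_3(s)}{\sqrt{(a-b)(a-c)}},\ \tfrac{g_1(n_1)g_2(n_2)g_3(s)}{\sqrt{(a-b)(b-c)}},\ \tfrac{h_1(n_1)h_2(n_2)h_3(s)}{\sqrt{(a-c)(b-c)}}\right)$$ with $f_1^{\mathbb 2}+g_1^{\mathbb 2}=a-b$, $f_1^{\mathbb 2}+h_1^{\mathbb 2}=a-c$, $f_2^{\mathbb 2}-g_2^{\mathbb 2}=a-b$, $f_2^{\mathbb 2}+h_2^{\mathbb 2}=a-c$ (discrete squares) and $f_3^2-g_3^2=a-b$, $f_3^2-h_3^2=a-c$ (ordinary squares). Two discrete ellipsoids are discrete confocal quadrics up to a scaling if they are uniform scalings of $\hat{\mathbf r}(\cdot,\cdot,s)$ and $\hat{\mathbf r}(\cdot,\cdot,s')$ for one such system and two values $s,s'$.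
   Formalization: A polygon n_1±n_2=p is claimed to be a discrete circle with R>0 only if |sin(δp)|<cos(δ/2) (otherwise R² is not positive; only the circle relation with a real constant is claimed), and in (ii) the meeting point may lie at infinity when sin(δp)=0. *)

(* Defs.v *)
From Stdlib Require Export Reals ZArith.
From Coquelicot Require Export Coquelicot.

Open Scope R_scope.

(* Conventions.  A point of (1/2)Z is represented by its double: the integer k
   stands for n = k/2, so n^+ and n^- are k + 1 and k - 1.  A pair (k, l) is a
   point of Z^2 if k and l are both even, and of (Z^2)^* = (Z + 1/2)^2 if they
   are both odd. *)

Definition half (k : Z) : R := IZR k / 2.

Definition primal (k l : Z) : Prop := Z.Even k /\ Z.Even l.
Definition dual (k l : Z) : Prop := Z.Odd k /\ Z.Odd l.

Definition R3 : Type := (R * R * R)%type.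

Definition px (p : R3) : R := fst (fst p).
Definition py (p : R3) : R := snd (fst p).
Definition pz (p : R3) : R := snd p.

Definition zero3 : R3 := (0, 0, 0).
Definition sub3 (p q : R3) : R3 := (px p - px q, py p - py q, pz p - pz q).
Definition scal3 (c : R) (p : R3) : R3 := (c * px p, c * py p, c * pz p).
Definition dot3 (p q : R3) : R := px p * px q + py p * py q + pz p * pz q.
Definition dist3 (p q : R3) : R := sqrt (dot3 (sub3 p q) (sub3 p q)).

Record plane : Type := Plane
  { normal : R3; offset : R; normal_neq0 : normal <> zero3 }.

Definition on_plane (P : plane) (p : R3) : Prop :=
  dot3 (normal P) p = offset P.

Definition parallel (P Q : plane) : Prop :=
  exists c : R, normal P = scal3 c (normal Q).

(* [v : w] are homogeneous coordinates of a point of projective space: the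
   point v / w if w <> 0, the point at infinity in direction v if w = 0. *)
Definition on_plane_proj (P : plane) (v : R3) (w : R) : Prop :=
  dot3 (normal P) v = offset P * w.

(* The values of [cpos] and [pos] are only relevant on [cdom] and [dom]. *)
Record curve : Type := Curve { cdom : Z -> Prop; cpos : Z -> R3 }.
Record net : Type := Net { dom : Z -> Z -> Prop; pos : Z -> Z -> R3 }.

Definition same_curve (c c' : curve) : Prop :=
  (forall k, cdom c k <-> cdom c' k) /\
  (forall k, cdom c k -> cpos c k = cpos c' k).

Definition same_net (r r' : net) : Prop :=
  (forall k l, dom r k l <-> dom r' k l) /\
  (forall k l, dom r k l -> pos r k l = pos r' k l).

(* The domain is U \cup U^* with U the points of [dom r] in Z^2 and U^* those
   in (Z^2)^*. *)
Definition is_binet (r : net) : Prop :=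
  forall k l, dom r k l -> primal k l \/ dual k l.

(* A binet translated by 1/2 in the first variable: it lives on the points of
   ((1/2)Z)^2 outside Z^2 \cup (Z^2)^*. *)
Definition is_shifted_binet (r : net) : Prop :=
  is_binet (Net (fun k l => dom r (k + 1)%Z l) (fun k l => pos r (k + 1)%Z l)).

Definition quad_in_dom (r : net) (k l : Z) : Prop :=
  dom r (k - 1) (l - 1) /\ dom r (k + 1) (l - 1) /\
  dom r (k + 1) (l + 1) /\ dom r (k - 1) (l + 1).

(* [P] passes through the elementary quadrilateral centred at (k, l); unless
   its four vertices are collinear this determines [P]. *)
Definition quad_plane (r : net) (k l : Z) (P : plane) : Prop :=
  on_plane P (pos r (k - 1) (l - 1)) /\ on_plane P (pos r (k + 1) (l - 1)) /\
  on_plane P (pos r (k + 1) (l + 1)) /\ on_plane P (pos r (k - 1) (l + 1)).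

(* [Box] is an assignment of planes to the elementary quadrilaterals of r. *)
Definition is_Box (r : net) (Box : Z -> Z -> plane) : Prop :=
  forall k l, quad_in_dom r k l -> quad_plane r k l (Box k l).

Definition principal (r : net) : Prop :=
  is_binet r /\
  (exists Box, is_Box r Box) /\
  (forall k l,
     dom r (k - 1) l -> dom r (k + 1) l -> dom r k (l - 1) -> dom r k (l + 1) ->
     dot3 (sub3 (pos r (k + 1) l) (pos r (k - 1) l))
          (sub3 (pos r k (l + 1)) (pos r k (l - 1))) = 0).

(* With n_+ = p/2 and n_- = q/2 one has n_1 = (p + q)/2 and n_2 = (p - q)/2;
   note that p = n_1 + n_2 and q = n_1 - n_2. *)
Definition in_diagonal (r : net) : net :=
  Net (fun p q => dom r (p + q) (p - q)) (fun p q => pos r (p + q) (p - q)).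

Definition line1 (r : net) (p : Z) : curve := Curve (dom r p) (pos r p).
Definition line2 (r : net) (q : Z) : curve :=
  Curve (fun p => dom r p q) (fun p => pos r p q).

(* The parameter polygons n_+ = p/2, indexed by n_-, and n_- = q/2, indexed by
   n_+. *)
Definition polygon_plus (r : net) (p : Z) : curve := line1 (in_diagonal r) p.
Definition polygon_minus (r : net) (q : Z) : curve := line2 (in_diagonal r) q.

(* b comes from U and b' from U^*. *)
Definition diagonal_pair (r b b' : net) : Prop :=
  is_binet b /\ is_shifted_binet b' /\
  (forall p q, dom b p q <->
     dom r (p + q) (p - q) /\ primal (p + q) (p - q)) /\
  (forall p q, dom b p q -> pos b p q = pos r (p + q) (p - q)) /\
  (forall p q, dom b' p q <->
     dom r (p + q) (p - q) /\ dual (p + q) (p - q)) /\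
  (forall p q, dom b' p q -> pos b' p q = pos r (p + q) (p - q)).

(* The common extension of a binet b and a shifted binet b'. *)
Definition union_net (b b' : net) : net :=
  Net (fun p q => dom b p q \/ dom b' p q)
      (fun p q => if Z.even (p + q) then pos b p q else pos b' p q).

(* c is a curve in P any two consecutive points of which are conjugate with
   respect to the circle in P with centre M and squared radius rho. *)
Definition conjugate_polygon (P : plane) (M : R3) (rho : R) (c : curve)
    : Prop :=
  on_plane P M /\
  (forall k, cdom c k -> on_plane P (cpos c k)) /\
  (forall k, cdom c k -> cdom c (k + 1)%Z ->
     dot3 (sub3 (cpos c k) M) (sub3 (cpos c (k + 1)%Z) M) = rho).

Definition discrete_circle_in (P : plane) (c : curve) : Prop :=
  exists (M : R3) (rad : R), 0 < rad /\ conjugate_polygon P M (rad ^ 2) c.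

Definition discrete_circle (c : curve) : Prop :=
  exists P, discrete_circle_in P c.

Definition congruent (c c' : curve) : Prop :=
  (forall k, cdom c k <-> cdom c' k) /\
  exists Phi : R3 -> R3,
    (forall p q, dist3 (Phi p) (Phi q) = dist3 p q) /\
    (forall k, cdom c k -> Phi (cpos c k) = cpos c' k).

(* The range of n_1 (resp. n_2): all indices between two values attained on
   the domain. *)
Definition range1 (r : net) (k : Z) : Prop :=
  exists i j i' j', dom r i i' /\ dom r j j' /\ (i <= k <= j)%Z.
Definition range2 (r : net) (l : Z) : Prop :=
  exists i j i' j', dom r i' i /\ dom r j' j /\ (i <= l <= j)%Z.

Definition dsq (f : Z -> R) (k : Z) : R := f k * f (k + 1)%Z.

Definition ell_f1 (alpha gamma delta : R) (k : Z) : R :=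
  sqrt ((alpha - gamma) / cos (delta / 2)) * sin (delta * half k).
Definition ell_f2 (alpha gamma delta : R) (k : Z) : R :=
  sqrt ((alpha - gamma) / cos (delta / 2)) * cos (delta * half k).

Definition admissible (alpha beta gamma delta : R) : Prop :=
  alpha > beta /\ beta > gamma /\ gamma > 0 /\ 0 < delta < PI.

Definition discrete_ellipsoid (alpha beta gamma delta : R) (r : net) : Prop :=
  is_binet r /\
  exists g1 g2 : Z -> R,
    (forall k, range1 r k -> range1 r (k + 1) ->
       g1 k <> 0 /\
       g1 (k + 1)%Z =
         (alpha - beta - dsq (ell_f1 alpha gamma delta) k) / g1 k) /\
    (forall l, range2 r l -> range2 r (l + 1) ->
       g2 l <> 0 /\
       g2 (l + 1)%Z =
         (dsq (ell_f2 alpha gamma delta) l - alpha + beta) / g2 l) /\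
    (forall k l, dom r k l ->
       pos r k l =
         (1 / cos (delta / 2)
            * sqrt (alpha * (alpha - gamma) / (alpha - beta))
            * sin (delta * half k) * cos (delta * half l),
          sqrt (beta / ((alpha - beta) * (beta - gamma))) * g1 k * g2 l,
          1 / cos (delta / 2)
            * sqrt (gamma * (alpha - gamma) / (beta - gamma))
            * cos (delta * half k) * sin (delta * half l))).

(* The cross section n_+ = p/2 (or n_- = p/2) has squared radius
   beta * (1 - sin(delta p)^2 / cos(delta/2)^2), which need not be positive on
   an arbitrary domain; for imaginary radii (for example p = 1,
   (alpha, beta, gamma) = (3, 2, 1), delta = 1.3) there is no discrete circle. *)
Definition real_section (delta : R) (p : Z) : Prop :=
  Rabs (sin (delta * IZR p)) < cos (delta / 2).

(* r t, for lo < t < hi, is a discrete ellipsoid of type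
   (alpha t, beta t, gamma t, delta t). *)
Definition ellipsoid_family (lo hi : R) (alpha beta gamma delta : R -> R)
    (r : R -> net) : Prop :=
  (forall t, lo < t < hi ->
     admissible (alpha t) (beta t) (gamma t) (delta t) /\
     discrete_ellipsoid (alpha t) (beta t) (gamma t) (delta t) (r t)) /\
  (forall t t' k l, lo < t < hi -> lo < t' < hi ->
     (dom (r t) k l <-> dom (r t') k l)).

Definition continuous_family (lo hi : R) (alpha beta gamma delta : R -> R)
    (r : R -> net) : Prop :=
  forall t, lo < t < hi ->
    continuous alpha t /\ continuous beta t /\
    continuous gamma t /\ continuous delta t /\
    (forall k l, dom (r t) k l -> continuous (fun s => pos (r s) k l : R3) t).

(* The family is a genuine deformation: its members are of pairwise different
   types and every vertex which is not on the y-axis moves. *)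
Definition nonconstant_family (lo hi : R) (alpha beta gamma delta : R -> R)
    (r : R -> net) : Prop :=
  forall t t', lo < t < hi -> lo < t' < hi -> t <> t' ->
    (alpha t, beta t, gamma t, delta t) <>
      (alpha t', beta t', gamma t', delta t') /\
    (forall k l, dom (r t) k l ->
       px (pos (r t) k l) <> 0 \/ pz (pos (r t) k l) <> 0 ->
       pos (r t) k l <> pos (r t') k l).

Record confocal_data : Type := ConfocalData
  { ca : R; cb : R; cc : R;
    cf1 : Z -> R; cg1 : Z -> R; ch1 : Z -> R;
    cf2 : Z -> R; cg2 : Z -> R; ch2 : Z -> R;
    cf3 : R -> R; cg3 : R -> R; ch3 : R -> R }.

Definition confocal_map (C : confocal_data) (k l : Z) (s : R) : R3 :=
  (cf1 C k * cf2 C l * cf3 C s / sqrt ((ca C - cb C) * (ca C - cc C)),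
   cg1 C k * cg2 C l * cg3 C s / sqrt ((ca C - cb C) * (cb C - cc C)),
   ch1 C k * ch2 C l * ch3 C s / sqrt ((ca C - cc C) * (cb C - cc C))).

(* A discrete confocal system over the domain of r and the parameters
   slo < s < shi. *)
Definition confocal_system (r : net) (slo shi : R) (C : confocal_data) : Prop :=
  ca C > cb C /\ cb C > cc C /\
  (forall k, range1 r k -> range1 r (k + 1) ->
     dsq (cf1 C) k + dsq (cg1 C) k = ca C - cb C /\
     dsq (cf1 C) k + dsq (ch1 C) k = ca C - cc C) /\
  (forall l, range2 r l -> range2 r (l + 1) ->
     dsq (cf2 C) l - dsq (cg2 C) l = ca C - cb C /\
     dsq (cf2 C) l + dsq (ch2 C) l = ca C - cc C) /\
  (forall s, slo < s < shi ->
     cf3 C s ^ 2 - cg3 C s ^ 2 = ca C - cb C /\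
     cf3 C s ^ 2 - ch3 C s ^ 2 = ca C - cc C /\
     continuous (cf3 C) s /\ continuous (cg3 C) s /\ continuous (ch3 C) s).

Definition confocal_up_to_scaling (r r' : net) : Prop :=
  (forall k l, dom r k l <-> dom r' k l) /\
  exists (slo shi s s' : R) (C : confocal_data) (lam lam' : R),
    confocal_system r slo shi C /\
    slo < s < shi /\ slo < s' < shi /\ 0 < lam /\ 0 < lam' /\
    (forall k l, dom r k l ->
       pos r k l = scal3 lam (confocal_map C k l s) /\
       pos r' k l = scal3 lam' (confocal_map C k l s')).

(* Main.v *)
Require Import Defs.
From Stdlib Require Import Lra Lia.

(** Write s = sin (delta n), c = cos (delta n).  The recurrences for g1 and g2
    imply that two points of the binet whose indices n_1 and n_2 both differ
    by 1/2 are conjugate with respect to the ellipsoid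
    x^2 / alpha + y^2 / beta + z^2 / gamma = 1 ([neighbours_conjugate]): the
    products g1 g1' and g2 g2' are affine in s s' and c c', and since
    c c' + s s' = cos (delta / 2) the terms depending on the indices cancel in
    the bilinear form.  Parts (i) and (ii) rest on this fact.

    - Along n_+ = const or n_- = const the product formulas for sin and cos
      make x / A + z / C or x / A - z / C constant, A and C being the
      coefficients of x and z.  These planes are cyclic planes of the
      ellipsoid: on each of them the ellipsoid induces the polarity of a
      circle, so consecutive vertices, being conjugate with respect to the
      ellipsoid, are conjugate with respect to that circle
      ([cyclic_section]).
    - The four vertices of the quadrilateral around an index are conjugate to
      the point with that index, so the plane of the quadrilateral is the polar
      plane of that point.  As the index runs along a circular section this
      point stays in the plane of the section, and the polar planes therefore
      pass through the pole of that plane ([section_planes_concurrent]).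

    The orthogonality of dual edges is a trigonometric identity in which the
    x and z terms together have the factor A^2 + C^2, which is the opposite of
    the factor of the y term ([dual_edges_orthogonal]).

    For (iv), keep beta and delta and move alpha and gamma linearly so that
    alpha - beta, beta - gamma and alpha - gamma are all multiplied by t.  Then
    A^2 + C^2 does not change, and with g1 and g2 multiplied by sqrt t neither
    does y.  Inside the plane of a circular section y and sqrt (A^2 + C^2)
    times a quantity independent of t are Cartesian coordinates of the
    vertices, so the section only undergoes a rigid motion
    ([congruent_sections]).  Dividing the member of parameter t by sqrt t gives
    squared semi-axes with differences independent of t, which is the confocal
    system ([deformed_confocal_pos]). *)

(** * The quadric and its polarity *)

Definition ell_form (alpha beta gamma : R) (p q : R3) : R :=
  px p * px q / alpha + py p * py q / beta + pz p * pz q / gamma.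

Definition polar_normal (alpha beta gamma : R) (p : R3) : R3 :=
  (px p / alpha, py p / beta, pz p / gamma).

Lemma dot3_polar_normal (alpha beta gamma : R) (p q : R3) :
  dot3 (polar_normal alpha beta gamma p) q = ell_form alpha beta gamma p q.
Proof.
unfold dot3, ell_form, polar_normal; simpl; unfold px, py, pz, Rdiv; simpl.
ring.
Qed.

Lemma neq0_of_dot3 (v : R3) : dot3 v v <> 0 -> v <> zero3.
Proof. intros H E; apply H; rewrite E; unfold dot3, px, py, pz; simpl; ring. Qed.

Lemma xaxis_neq0 : (1, 0, 0) <> zero3.
Proof. unfold zero3; intros H; injection H; lra. Qed.

(** The polar plane of a point other than the centre of the ellipsoid.  At the
    centre, which has no polar plane, the value is an arbitrary plane; the test
    on the squared norm decides whether the normal vector vanishes. *)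
Definition polar_plane (alpha beta gamma : R) (p : R3) : plane :=
  let v := polar_normal alpha beta gamma p in
  match Req_EM_T (dot3 v v) 0 with
  | left _ => Plane (1, 0, 0) 0 xaxis_neq0
  | right h => Plane v 1 (neq0_of_dot3 v h)
  end.

(** A point with some non-zero product under the form is not the centre, so
    its polar plane is the genuine one. *)
Lemma polar_plane_spec (alpha beta gamma : R) (p q : R3) :
  ell_form alpha beta gamma p q <> 0 ->
  normal (polar_plane alpha beta gamma p) = polar_normal alpha beta gamma p /\
  offset (polar_plane alpha beta gamma p) = 1.
Proof.
intros H; unfold polar_plane.
destruct (Req_EM_T _ 0) as [E | E]; simpl; [exfalso | split; reflexivity].
apply H; rewrite <- dot3_polar_normal.
destruct (polar_normal alpha beta gamma p) as [[a b] c].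
unfold dot3, px, py, pz in *; simpl in *.
assert (a = 0) by nra; assert (b = 0) by nra; assert (c = 0) by nra.
subst; ring.
Qed.

(** * Circular sections *)

Lemma cyclic_normal_neq0 (A C : R) : A <> 0 -> (/ A, 0, / C) <> zero3.
Proof.
intros HA H; unfold zero3 in H; injection H; intros _ E.
exact (Rinv_neq_0_compat A HA E).
Qed.

Definition cyclic_plane (A C : R) (HA : A <> 0) (S : R) : plane :=
  Plane (/ A, 0, / C) S (cyclic_normal_neq0 A C HA).

Lemma cyclic_planes_parallel (A C : R) (HA : A <> 0) (S S' : R) :
  parallel (cyclic_plane A C HA S) (cyclic_plane A C HA S').
Proof.
exists 1; unfold scal3, px, py, pz; simpl.
repeat apply f_equal2; ring.
Qed.

(** Put x = A X, z = C (S - X) in the plane.  The coefficient of X X' in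
    beta (x x' / alpha + z z' / gamma) is A^2 + C^2, the same as in
    x x' + z z', which is what makes the plane cyclic; so the polarity of the
    section is that of a circle, and M is the point where the terms linear in
    X and X' cancel.  The number C may be negative, which covers both
    families of cyclic planes. *)
Lemma cyclic_section (alpha beta gamma c A C S : R) (p q : R3) :
  alpha > beta -> beta > gamma -> gamma > 0 -> c <> 0 ->
  A <> 0 -> C <> 0 ->
  A ^ 2 = alpha * (alpha - gamma) / (alpha - beta) / c ^ 2 ->
  C ^ 2 = gamma * (alpha - gamma) / (beta - gamma) / c ^ 2 ->
  px p / A + pz p / C = S -> px q / A + pz q / C = S ->
  ell_form alpha beta gamma p q = 1 ->
  let M := (A * S * (alpha - beta) / (alpha - gamma), 0,
            C * S * (beta - gamma) / (alpha - gamma)) in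
  dot3 (sub3 p M) (sub3 q M) = beta * (1 - S ^ 2 / c ^ 2).
Proof.
destruct p as [[x y] z], q as [[x' y'] z'].
unfold ell_form, dot3, sub3, px, py, pz; simpl fst; simpl snd.
intros Hab Hbc Hc Hc0 HA HC EA EC Hp Hq E.
assert (Ex : x = A * (x / A)) by (field; assumption).
assert (Ex' : x' = A * (x' / A)) by (field; assumption).
assert (Ez : z = C * (S - x / A)) by (rewrite <- Hp; field; split; assumption).
assert (Ez' : z' = C * (S - x' / A)) by (rewrite <- Hq; field; split; assumption).
revert Ex Ex' Ez Ez'; generalize (x / A) (x' / A); intros X X' -> -> -> ->.
clear Hp Hq.
assert (Ey : y * y' = beta * (1 - A ^ 2 * (X * X') / alpha
                                - C ^ 2 * ((S - X) * (S - X')) / gamma)).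
{ rewrite <- E; field; lra. }
transitivity
  (A ^ 2 * ((X - S * (alpha - beta) / (alpha - gamma))
            * (X' - S * (alpha - beta) / (alpha - gamma)))
   + y * y'
   + C ^ 2 * ((S - X - S * (beta - gamma) / (alpha - gamma))
              * (S - X' - S * (beta - gamma) / (alpha - gamma)))).
{ field; lra. }
rewrite Ey, EA, EC; field; repeat split; lra.
Qed.

(** The polarity of the section depends only on the plane, so one centre and
    one squared radius serve all pairs of consecutive vertices. *)
Lemma section_conjugate_polygon
  (alpha beta gamma c A C S : R) (HA : A <> 0) (cv : curve) :
  alpha > beta -> beta > gamma -> gamma > 0 -> c <> 0 -> C <> 0 ->
  A ^ 2 = alpha * (alpha - gamma) / (alpha - beta) / c ^ 2 ->
  C ^ 2 = gamma * (alpha - gamma) / (beta - gamma) / c ^ 2 ->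
  (forall k, cdom cv k -> px (cpos cv k) / A + pz (cpos cv k) / C = S) ->
  (forall k, cdom cv k -> cdom cv (k + 1)%Z ->
     ell_form alpha beta gamma (cpos cv k) (cpos cv (k + 1)%Z) = 1) ->
  exists M, conjugate_polygon (cyclic_plane A C HA S) M
              (beta * (1 - S ^ 2 / c ^ 2)) cv.
Proof.
intros Hab Hbc Hc Hc0 HC EA EC Hpl Hcj.
exists (A * S * (alpha - beta) / (alpha - gamma), 0,
        C * S * (beta - gamma) / (alpha - gamma)).
split; [| split].
- unfold on_plane, dot3, px, py, pz; simpl; field; repeat split; lra.
- intros k Hk; rewrite <- (Hpl k Hk).
  unfold on_plane, dot3; simpl; rewrite (Hpl k Hk), <- (Hpl k Hk).
  unfold px, py, pz; simpl; field; split; assumption.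
- intros k Hk Hk1; apply cyclic_section; auto.
Qed.

Lemma real_radius (beta c S : R) (P : plane) (M : R3) (cv : curve) :
  beta > 0 -> Rabs S < c ->
  conjugate_polygon P M (beta * (1 - S ^ 2 / c ^ 2)) cv ->
  discrete_circle_in P cv.
Proof.
intros Hb HS H.
assert (Hc : 0 < c) by (pose proof (Rabs_pos S); lra).
assert (Hr : 0 < beta * (1 - S ^ 2 / c ^ 2)).
{ apply Rmult_lt_0_compat; [lra |].
  assert (S ^ 2 < c ^ 2) by (apply Rabs_def2 in HS; nra).
  assert (0 < c ^ 2) by nra.
  apply Rlt_0_minus, Rmult_lt_reg_r with (c ^ 2); [assumption |].
  unfold Rdiv; rewrite Rmult_assoc, Rinv_l; lra. }
exists M, (sqrt (beta * (1 - S ^ 2 / c ^ 2))); split.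
- apply sqrt_lt_R0; exact Hr.
- rewrite pow2_sqrt; [exact H | lra].
Qed.

Lemma same_curve_circle (c c' : curve) :
  same_curve c c' -> discrete_circle c' -> discrete_circle c.
Proof.
intros [Hd He] [P [M [rad [Hr [HM [Hp Hc]]]]]].
exists P, M, rad; split; [exact Hr | split; [exact HM | split]].
- intros k Hk; rewrite (He k Hk); apply Hp, Hd, Hk.
- intros k Hk Hk1; rewrite (He k Hk), (He _ Hk1).
  apply Hc; apply Hd; assumption.
Qed.

(** * The parametrisation of a discrete ellipsoid *)

Definition sn (delta : R) (k : Z) : R := sin (delta * half k).
Definition cs (delta : R) (k : Z) : R := cos (delta * half k).

Definition axis1 (alpha beta gamma delta : R) : R :=
  1 / cos (delta / 2) * sqrt (alpha * (alpha - gamma) / (alpha - beta)).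
Definition axis2 (alpha beta gamma : R) : R :=
  sqrt (beta / ((alpha - beta) * (beta - gamma))).
Definition axis3 (alpha beta gamma delta : R) : R :=
  1 / cos (delta / 2) * sqrt (gamma * (alpha - gamma) / (beta - gamma)).

Definition ell_point (alpha beta gamma delta : R) (g1 g2 : Z -> R) (k l : Z)
    : R3 :=
  (axis1 alpha beta gamma delta * sn delta k * cs delta l,
   axis2 alpha beta gamma * g1 k * g2 l,
   axis3 alpha beta gamma delta * cs delta k * sn delta l).

Definition adjacent (k k' : Z) : Prop := k' = (k + 1)%Z \/ k = (k' + 1)%Z.

(** The recurrences for g1 and g2 as product rules.  Unlike the recurrences,
    these are invariant under exchanging the two indices, so that steps of
    either orientation are treated alike; n_1 and n_2 move in opposite
    directions along n_+ = const. *)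
Definition profiles (alpha beta gamma delta : R) (r : net) (g1 g2 : Z -> R)
    : Prop :=
  (forall k k', adjacent k k' -> range1 r k -> range1 r k' ->
     g1 k * g1 k' = alpha - beta
       - (alpha - gamma) / cos (delta / 2) * (sn delta k * sn delta k')) /\
  (forall l l', adjacent l l' -> range2 r l -> range2 r l' ->
     g2 l * g2 l' =
       (alpha - gamma) / cos (delta / 2) * (cs delta l * cs delta l')
       - (alpha - beta)).

Lemma cos_half_pos (delta : R) : 0 < delta < PI -> 0 < cos (delta / 2).
Proof. intros H; apply cos_gt_0; lra. Qed.

Lemma admissible_ellipsoid_profiles (alpha beta gamma delta : R) (r : net) :
  admissible alpha beta gamma delta ->
  discrete_ellipsoid alpha beta gamma delta r ->
  exists g1 g2, profiles alpha beta gamma delta r g1 g2 /\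
    forall k l, dom r k l -> pos r k l = ell_point alpha beta gamma delta g1 g2 k l.
Proof.
intros (Hab & Hbc & Hc & Hd) (_ & g1 & g2 & H1 & H2 & Hp).
assert (Hcos := cos_half_pos delta Hd).
assert (Hs : sqrt ((alpha - gamma) / cos (delta / 2)) ^ 2
             = (alpha - gamma) / cos (delta / 2)).
{ apply pow2_sqrt, Rlt_le, Rdiv_lt_0_compat; lra. }
exists g1, g2; split; [split | exact Hp].
- assert (W : forall k, range1 r k -> range1 r (k + 1) ->
     g1 k * g1 (k + 1)%Z = alpha - beta - (alpha - gamma) / cos (delta / 2)
       * (sn delta k * sn delta (k + 1))).
  { intros k Hk Hk1; destruct (H1 k Hk Hk1) as [Hn ->].
    rewrite <- Hs; unfold dsq, ell_f1, sn; field; exact Hn. }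
  intros k k' [-> | ->] Hk Hk'; [apply W; assumption |].
  rewrite Rmult_comm, (Rmult_comm (sn _ _)); apply W; assumption.
- assert (W : forall l, range2 r l -> range2 r (l + 1) ->
     g2 l * g2 (l + 1)%Z = (alpha - gamma) / cos (delta / 2)
       * (cs delta l * cs delta (l + 1)) - (alpha - beta)).
  { intros l Hl Hl1; destruct (H2 l Hl Hl1) as [Hn ->].
    rewrite <- Hs; unfold dsq, ell_f2, cs; field; exact Hn. }
  intros l l' [-> | ->] Hl Hl'; [apply W; assumption |].
  rewrite Rmult_comm, (Rmult_comm (cs _ _)); apply W; assumption.
Qed.

Lemma half_succ (delta : R) (k : Z) :
  delta * half (k + 1) = delta * half k + delta / 2.
Proof. unfold half; rewrite plus_IZR; lra. Qed.

Lemma sn_succ (delta : R) (k : Z) :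
  sn delta (k + 1)
  = sn delta k * cos (delta / 2) + cs delta k * sin (delta / 2).
Proof. unfold sn, cs; rewrite half_succ; apply sin_plus. Qed.

Lemma cs_succ (delta : R) (k : Z) :
  cs delta (k + 1)
  = cs delta k * cos (delta / 2) - sn delta k * sin (delta / 2).
Proof. unfold sn, cs; rewrite half_succ; apply cos_plus. Qed.

Lemma half_pred (delta : R) (k : Z) :
  delta * half (k - 1) = delta * half k - delta / 2.
Proof. unfold half; rewrite minus_IZR; lra. Qed.

Lemma sn_pred (delta : R) (k : Z) :
  sn delta (k - 1)
  = sn delta k * cos (delta / 2) - cs delta k * sin (delta / 2).
Proof. unfold sn, cs; rewrite half_pred; apply sin_minus. Qed.

Lemma cs_pred (delta : R) (k : Z) :
  cs delta (k - 1)
  = cs delta k * cos (delta / 2) + sn delta k * sin (delta / 2).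
Proof. unfold sn, cs; rewrite half_pred; apply cos_minus. Qed.

Lemma adjacent_cos (delta : R) (k k' : Z) :
  adjacent k k' ->
  cs delta k * cs delta k' + sn delta k * sn delta k' = cos (delta / 2).
Proof.
assert (W : forall j, cs delta j * cs delta (j + 1) + sn delta j * sn delta (j + 1)
                      = cos (delta / 2)).
{ intros j; rewrite sn_succ, cs_succ.
  pose proof (sin2_cos2 (delta * half j)) as E; unfold Rsqr in E.
  fold (sn delta j) (cs delta j) in E.
  transitivity ((sn delta j * sn delta j + cs delta j * cs delta j)
                * cos (delta / 2)); [ring | rewrite E; ring]. }
intros [-> | ->]; [apply W |].
rewrite (Rmult_comm (cs _ _)), (Rmult_comm (sn _ _)); apply W.
Qed.

(** On the diagonals the x and z coordinates separate: up to the factors A and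
    C they are half the sum and half the difference of a function of n_+ and
    the same function of n_-. *)
Lemma sn_cs_diagonal (delta : R) (p q : Z) :
  sn delta (p + q) * cs delta (p - q)
  = (sin (delta * IZR p) + sin (delta * IZR q)) / 2.
Proof.
unfold sn, cs, half.
replace (sin (delta * IZR p))
  with (sin (delta * (IZR (p + q) / 2) + delta * (IZR (p - q) / 2)))
  by (f_equal; rewrite plus_IZR, minus_IZR; lra).
replace (sin (delta * IZR q))
  with (sin (delta * (IZR (p + q) / 2) - delta * (IZR (p - q) / 2)))
  by (f_equal; rewrite plus_IZR, minus_IZR; lra).
rewrite sin_plus, sin_minus; lra.
Qed.

Lemma cs_sn_diagonal (delta : R) (p q : Z) :
  cs delta (p + q) * sn delta (p - q)
  = (sin (delta * IZR p) - sin (delta * IZR q)) / 2.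
Proof.
unfold sn, cs, half.
replace (sin (delta * IZR p))
  with (sin (delta * (IZR (p + q) / 2) + delta * (IZR (p - q) / 2)))
  by (f_equal; rewrite plus_IZR, minus_IZR; lra).
replace (sin (delta * IZR q))
  with (sin (delta * (IZR (p + q) / 2) - delta * (IZR (p - q) / 2)))
  by (f_equal; rewrite plus_IZR, minus_IZR; lra).
rewrite sin_plus, sin_minus; lra.
Qed.

Section Axes.

Variables alpha beta gamma delta : R.
Hypothesis adm : admissible alpha beta gamma delta.

Let Hab : alpha > beta. Proof. apply adm. Qed.
Let Hbc : beta > gamma. Proof. apply adm. Qed.
Let Hc : gamma > 0. Proof. apply adm. Qed.
Let Hcos : 0 < cos (delta / 2). Proof. apply cos_half_pos, adm. Qed.

Lemma axis1_pos : 0 < axis1 alpha beta gamma delta.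
Proof.
apply Rmult_lt_0_compat; [apply Rdiv_lt_0_compat; lra |].
apply sqrt_lt_R0, Rdiv_lt_0_compat; [apply Rmult_lt_0_compat |]; lra.
Qed.

Lemma axis3_pos : 0 < axis3 alpha beta gamma delta.
Proof.
apply Rmult_lt_0_compat; [apply Rdiv_lt_0_compat; lra |].
apply sqrt_lt_R0, Rdiv_lt_0_compat; [apply Rmult_lt_0_compat |]; lra.
Qed.

Lemma axis2_pos : 0 < axis2 alpha beta gamma.
Proof.
apply sqrt_lt_R0, Rdiv_lt_0_compat; [| apply Rmult_lt_0_compat]; lra.
Qed.

Lemma axis1_sqr :
  axis1 alpha beta gamma delta ^ 2
  = alpha * (alpha - gamma) / (alpha - beta) / cos (delta / 2) ^ 2.
Proof.
unfold axis1; rewrite Rpow_mult_distr, pow2_sqrt; [field; lra |].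
apply Rlt_le, Rdiv_lt_0_compat; [apply Rmult_lt_0_compat |]; lra.
Qed.

Lemma axis2_sqr :
  axis2 alpha beta gamma ^ 2 = beta / ((alpha - beta) * (beta - gamma)).
Proof.
unfold axis2; rewrite pow2_sqrt; [reflexivity |].
apply Rlt_le, Rdiv_lt_0_compat; [| apply Rmult_lt_0_compat]; lra.
Qed.

Lemma axis3_sqr :
  axis3 alpha beta gamma delta ^ 2
  = gamma * (alpha - gamma) / (beta - gamma) / cos (delta / 2) ^ 2.
Proof.
unfold axis3; rewrite Rpow_mult_distr, pow2_sqrt; [field; lra |].
apply Rlt_le, Rdiv_lt_0_compat; [apply Rmult_lt_0_compat |]; lra.
Qed.

(** After clearing denominators, with a = (s s')(n_1) / cos (delta / 2) and
    b = (c c')(n_2) / cos (delta / 2), the form is the sum of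
    (alpha - gamma) (beta - gamma) a b,
    (alpha - gamma) (alpha - beta) (1 - a) (1 - b) and
    (alpha - beta - (alpha - gamma) a) ((alpha - gamma) b - (alpha - beta)),
    over (alpha - beta) (beta - gamma); the terms containing a or b cancel.
    The indices only have to lie in the ranges of n_1 and n_2: the pair
    itself need not belong to the domain of the binet. *)
Lemma neighbours_conjugate (r : net) (g1 g2 : Z -> R) (k l k' l' : Z) :
  profiles alpha beta gamma delta r g1 g2 ->
  adjacent k k' -> adjacent l l' ->
  range1 r k -> range1 r k' -> range2 r l -> range2 r l' ->
  ell_form alpha beta gamma
    (ell_point alpha beta gamma delta g1 g2 k l)
    (ell_point alpha beta gamma delta g1 g2 k' l') = 1.
Proof.
intros [P1 P2] Ak Al Rk Rk' Rl Rl'.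
assert (E1 := P1 _ _ Ak Rk Rk'); assert (E2 := P2 _ _ Al Rl Rl').
assert (T1 := adjacent_cos delta _ _ Ak); assert (T2 := adjacent_cos delta _ _ Al).
unfold ell_form, ell_point, px, py, pz; simpl fst; simpl snd.
transitivity
  (axis1 alpha beta gamma delta ^ 2 * (sn delta k * sn delta k')
     * (cs delta l * cs delta l') / alpha
   + axis2 alpha beta gamma ^ 2 * (g1 k * g1 k') * (g2 l * g2 l') / beta
   + axis3 alpha beta gamma delta ^ 2 * (cs delta k * cs delta k')
     * (sn delta l * sn delta l') / gamma).
{ field; lra. }
replace (cs delta k * cs delta k')
  with (cos (delta / 2) - sn delta k * sn delta k') by lra.
replace (sn delta l * sn delta l')
  with (cos (delta / 2) - cs delta l * cs delta l') by lra.
rewrite axis1_sqr, axis2_sqr, axis3_sqr, E1, E2.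
field; repeat split; lra.
Qed.

(** Each coordinate of the inner product is a multiple of
    (s c)(n_1) (s c)(n_2): for y because only the differences of two
    consecutive products g1 g1' and g2 g2' occur.  The total coefficient
    vanishes since A^2 + C^2 is
    ((alpha - gamma) / cos (delta / 2))^2 times the square of the coefficient
    of y. *)
Lemma dual_edges_orthogonal (r : net) (g1 g2 : Z -> R) (k l : Z) :
  profiles alpha beta gamma delta r g1 g2 ->
  range1 r (k - 1) -> range1 r k -> range1 r (k + 1) ->
  range2 r (l - 1) -> range2 r l -> range2 r (l + 1) ->
  let pt := ell_point alpha beta gamma delta g1 g2 in
  dot3 (sub3 (pt (k + 1)%Z l) (pt (k - 1)%Z l))
       (sub3 (pt k (l + 1)%Z) (pt k (l - 1)%Z)) = 0.
Proof.
intros [P1 P2] Rk0 Rk Rk1 Rl0 Rl Rl1 pt.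
assert (E1 : g1 k * g1 (k + 1)%Z - g1 k * g1 (k - 1)%Z
             = - (2 * (alpha - gamma) * sin (delta / 2) / cos (delta / 2)
                  * (sn delta k * cs delta k))).
{ rewrite (P1 k (k + 1)%Z), (P1 k (k - 1)%Z), sn_succ, sn_pred;
    try assumption; [field; lra | right; lia | left; lia]. }
assert (E2 : g2 l * g2 (l + 1)%Z - g2 l * g2 (l - 1)%Z
             = - (2 * (alpha - gamma) * sin (delta / 2) / cos (delta / 2)
                  * (sn delta l * cs delta l))).
{ rewrite (P2 l (l + 1)%Z), (P2 l (l - 1)%Z), cs_succ, cs_pred;
    try assumption; [field; lra | right; lia | left; lia]. }
unfold pt, dot3, sub3, ell_point, px, py, pz; simpl fst; simpl snd.
rewrite !sn_succ, !sn_pred, !cs_succ, !cs_pred.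
transitivity
  (axis2 alpha beta gamma ^ 2
     * (g1 k * g1 (k + 1)%Z - g1 k * g1 (k - 1)%Z)
     * (g2 l * g2 (l + 1)%Z - g2 l * g2 (l - 1)%Z)
   - 4 * sin (delta / 2) ^ 2
     * (sn delta k * cs delta k * (sn delta l * cs delta l))
     * (axis1 alpha beta gamma delta ^ 2 + axis3 alpha beta gamma delta ^ 2)).
{ ring. }
rewrite E1, E2, axis1_sqr, axis2_sqr, axis3_sqr.
field; repeat split; lra.
Qed.

End Axes.

Lemma dom_range (r : net) (k l : Z) : dom r k l -> range1 r k /\ range2 r l.
Proof.
intros H; split.
- exists k, k, l, l; repeat split; auto; lia.
- exists l, l, k, k; repeat split; auto; lia.
Qed.

(** The centre of a quadrilateral may be missing from the domain, but its
    coordinates lie between those of the vertices. *)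
Lemma quad_range (r : net) (k l : Z) :
  quad_in_dom r k l ->
  range1 r (k - 1) /\ range1 r k /\ range1 r (k + 1) /\
  range2 r (l - 1) /\ range2 r l /\ range2 r (l + 1).
Proof.
intros (H1 & _ & H3 & _).
destruct (dom_range _ _ _ H1), (dom_range _ _ _ H3).
repeat split; try assumption.
- exists (k - 1)%Z, (k + 1)%Z, (l - 1)%Z, (l + 1)%Z; repeat split; auto; lia.
- exists (l - 1)%Z, (l + 1)%Z, (k - 1)%Z, (k + 1)%Z; repeat split; auto; lia.
Qed.

(** * Circles, cones and orthogonality on a discrete ellipsoid *)

Section Chart.

Variables (alpha beta gamma delta : R) (r : net) (g1 g2 : Z -> R).
Hypothesis adm : admissible alpha beta gamma delta.
Hypothesis Hprof : profiles alpha beta gamma delta r g1 g2.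
Hypothesis Hpos : forall k l, dom r k l ->
  pos r k l = ell_point alpha beta gamma delta g1 g2 k l.

Let A := axis1 alpha beta gamma delta.
Let C := axis3 alpha beta gamma delta.
Let HA : A <> 0.
Proof. apply Rgt_not_eq, axis1_pos, adm. Qed.
Let HC : C <> 0.
Proof. apply Rgt_not_eq, axis3_pos, adm. Qed.
Let HmC : - C <> 0.
Proof. apply Ropp_neq_0_compat, HC. Qed.
Let Hc0 : cos (delta / 2) <> 0.
Proof. apply Rgt_not_eq, cos_half_pos, adm. Qed.

Lemma ell_point_plus (p q : Z) :
  px (ell_point alpha beta gamma delta g1 g2 (p + q) (p - q)) / A
  + pz (ell_point alpha beta gamma delta g1 g2 (p + q) (p - q)) / C
  = sin (delta * IZR p).
Proof.
transitivity (sn delta (p + q) * cs delta (p - q)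
              + cs delta (p + q) * sn delta (p - q)).
- unfold ell_point, px, pz; simpl fst; simpl snd; fold A C.
  field; split; [exact HC | exact HA].
- rewrite sn_cs_diagonal, cs_sn_diagonal; lra.
Qed.

Lemma ell_point_minus (p q : Z) :
  px (ell_point alpha beta gamma delta g1 g2 (p + q) (p - q)) / A
  + pz (ell_point alpha beta gamma delta g1 g2 (p + q) (p - q)) / - C
  = sin (delta * IZR q).
Proof.
transitivity (sn delta (p + q) * cs delta (p - q)
              - cs delta (p + q) * sn delta (p - q)).
- unfold ell_point, px, pz; simpl fst; simpl snd; fold A C.
  field; split; [exact HC | exact HA].
- rewrite sn_cs_diagonal, cs_sn_diagonal; lra.
Qed.

Lemma diagonal_neighbours_conjugate (k l k' l' : Z) :
  adjacent k k' -> adjacent l l' -> dom r k l -> dom r k' l' ->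
  ell_form alpha beta gamma (pos r k l) (pos r k' l') = 1.
Proof.
intros Ak Al H H'; rewrite (Hpos _ _ H), (Hpos _ _ H').
destruct (dom_range _ _ _ H), (dom_range _ _ _ H').
apply neighbours_conjugate with r; assumption.
Qed.

Lemma polygon_plus_conjugate (p : Z) :
  exists M, conjugate_polygon (cyclic_plane A C HA (sin (delta * IZR p))) M
    (beta * (1 - sin (delta * IZR p) ^ 2 / cos (delta / 2) ^ 2))
    (polygon_plus r p).
Proof.
destruct adm as (Hab & Hbc & Hc & Hd).
apply section_conjugate_polygon with alpha gamma; auto.
- apply axis1_sqr, adm.
- apply axis3_sqr, adm.
- simpl; intros q Hq; rewrite (Hpos _ _ Hq); apply ell_point_plus.
- simpl; intros q Hq Hq'; apply diagonal_neighbours_conjugate; auto.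
  + left; lia.
  + right; lia.
Qed.

Lemma polygon_minus_conjugate (q : Z) :
  exists M, conjugate_polygon (cyclic_plane A (- C) HA (sin (delta * IZR q))) M
    (beta * (1 - sin (delta * IZR q) ^ 2 / cos (delta / 2) ^ 2))
    (polygon_minus r q).
Proof.
destruct adm as (Hab & Hbc & Hc & Hd).
apply section_conjugate_polygon with alpha gamma; auto.
- apply axis1_sqr, adm.
- replace ((- C) ^ 2) with (C ^ 2) by ring; apply axis3_sqr, adm.
- simpl; intros p Hp; rewrite (Hpos _ _ Hp); apply ell_point_minus.
- simpl; intros p Hp Hp'; apply diagonal_neighbours_conjugate; auto; left; lia.
Qed.

Lemma sections_in_parallel_planes :
  exists Pp Pm : Z -> plane,
     (forall p p', parallel (Pp p) (Pp p')) /\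
     (forall q q', parallel (Pm q) (Pm q')) /\
     (forall p, exists M rho,
        conjugate_polygon (Pp p) M rho (polygon_plus r p)) /\
     (forall q, exists M rho,
        conjugate_polygon (Pm q) M rho (polygon_minus r q)) /\
     (forall p, real_section delta p ->
        discrete_circle_in (Pp p) (polygon_plus r p)) /\
     (forall q, real_section delta q ->
        discrete_circle_in (Pm q) (polygon_minus r q)).
Proof.
assert (Hb : beta > 0) by (destruct adm as (? & ? & ? & _); lra).
exists (fun p => cyclic_plane A C HA (sin (delta * IZR p))).
exists (fun q => cyclic_plane A (- C) HA (sin (delta * IZR q))).
split; [| split; [| split; [| split; [| split]]]].
- intros; apply cyclic_planes_parallel.
- intros; apply cyclic_planes_parallel.
- intros p; destruct (polygon_plus_conjugate p) as [M H]; eauto.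
- intros q; destruct (polygon_minus_conjugate q) as [M H]; eauto.
- intros p Hp; destruct (polygon_plus_conjugate p) as [M H].
  exact (real_radius _ _ _ _ _ _ Hb Hp H).
- intros q Hq; destruct (polygon_minus_conjugate q) as [M H].
  exact (real_radius _ _ _ _ _ _ Hb Hq H).
Qed.

(** The plane of the quadrilateral centred at (k, l), as the polar plane of
    the point that the parametrisation attaches to (k, l). *)
Definition polar_box (k l : Z) : plane :=
  polar_plane alpha beta gamma (ell_point alpha beta gamma delta g1 g2 k l).

(** The vertices of a quadrilateral are diagonal neighbours of its centre,
    hence conjugate to it; in particular the centre of the quadrilateral is
    not the centre of the ellipsoid and has a polar plane. *)
Lemma polar_box_vertex (k l k' l' : Z) :
  quad_in_dom r k l -> adjacent k k' -> adjacent l l' ->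
  dom r k' l' ->
  normal (polar_box k l)
    = polar_normal alpha beta gamma (ell_point alpha beta gamma delta g1 g2 k l) /\
  offset (polar_box k l) = 1 /\
  on_plane (polar_box k l) (pos r k' l').
Proof.
intros Hq Ak Al Hd.
destruct (quad_range _ _ _ Hq) as (_ & Rk & _ & _ & Rl & _).
destruct (dom_range _ _ _ Hd).
assert (E := neighbours_conjugate _ _ _ _ adm _ _ _ k l k' l' Hprof Ak Al
               Rk ltac:(assumption) Rl ltac:(assumption)).
destruct (polar_plane_spec alpha beta gamma
            (ell_point alpha beta gamma delta g1 g2 k l)
            (ell_point alpha beta gamma delta g1 g2 k' l')) as [En Eo].
{ rewrite E; lra. }
unfold on_plane, polar_box; rewrite En, Eo, dot3_polar_normal, (Hpos _ _ Hd).
auto.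
Qed.

Lemma polar_box_is_Box : is_Box r polar_box.
Proof.
intros k l Hq; pose proof Hq as (H1 & H2 & H3 & H4).
repeat split; apply (polar_box_vertex k l); auto;
  try (left; lia); right; lia.
Qed.

Lemma polar_box_through (k l : Z) (v : R3) (w : R) :
  quad_in_dom r k l ->
  ell_form alpha beta gamma (ell_point alpha beta gamma delta g1 g2 k l) v = w ->
  on_plane_proj (polar_box k l) v w.
Proof.
intros Hq Hv; pose proof Hq as (_ & _ & H3 & _).
(* any vertex will do: it only certifies that the polar plane is genuine *)
destruct (polar_box_vertex k l (k + 1) (l + 1) Hq) as (En & Eo & _);
  [left; lia | left; lia | exact H3 |].
unfold on_plane_proj; rewrite En, Eo, dot3_polar_normal, Hv; ring.
Qed.

(** The common point is the pole of the plane of the section.  The pole of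
    x / A + z / D = S, with D equal to C or - C, has homogeneous coordinates
    [alpha / A : 0 : gamma / D : S]: its product with a point under the form
    is x / A + z / D. *)
Lemma section_planes_concurrent :
  exists Box : Z -> Z -> plane,
     is_Box r Box /\
     (forall p, exists (v : R3) (w : R),
        (v <> zero3 \/ w <> 0) /\
        (sin (delta * IZR p) <> 0 -> w <> 0) /\
        forall q, cdom (polygon_plus r p) q ->
          quad_in_dom r (p + q) (p - q) ->
          on_plane_proj (Box (p + q)%Z (p - q)%Z) v w) /\
     (forall q, exists (v : R3) (w : R),
        (v <> zero3 \/ w <> 0) /\
        (sin (delta * IZR q) <> 0 -> w <> 0) /\
        forall p, cdom (polygon_minus r q) p ->
          quad_in_dom r (p + q) (p - q) ->
          on_plane_proj (Box (p + q)%Z (p - q)%Z) v w).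
Proof.
destruct adm as (Hab & Hbc & Hc & Hd).
assert (Hv : forall D, (alpha / A, 0, gamma / D) <> zero3).
{ intros D H; unfold zero3 in H; injection H; intros _ E.
  apply Rmult_eq_compat_r with (r := A) in E.
  unfold Rdiv in E; rewrite Rmult_assoc, Rinv_l, Rmult_0_l in E; lra. }
exists polar_box; split; [exact polar_box_is_Box | split].
- intros p; exists (alpha / A, 0, gamma / C), (sin (delta * IZR p)).
  split; [left; apply Hv | split; [auto |]].
  intros q _ Hq; apply polar_box_through; [exact Hq |].
  rewrite <- (ell_point_plus p q); unfold ell_form.
  unfold px at 2, py at 2, pz at 2; simpl fst; simpl snd.
  field; repeat split; auto; lra.
- intros q; exists (alpha / A, 0, gamma / - C), (sin (delta * IZR q)).
  split; [left; apply Hv | split; [auto |]].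
  intros p _ Hq; apply polar_box_through; [exact Hq |].
  rewrite <- (ell_point_minus p q); unfold ell_form.
  unfold px at 2, py at 2, pz at 2; simpl fst; simpl snd.
  field; repeat split; auto; lra.
Qed.

Lemma ellipsoid_principal : is_binet r -> principal r.
Proof.
intros Hb; split; [exact Hb | split].
- exists polar_box; exact polar_box_is_Box.
- intros k l D1 D2 D3 D4.
  destruct (dom_range _ _ _ D1), (dom_range _ _ _ D2),
    (dom_range _ _ _ D3), (dom_range _ _ _ D4).
  rewrite (Hpos _ _ D1), (Hpos _ _ D2), (Hpos _ _ D3), (Hpos _ _ D4).
  apply dual_edges_orthogonal with r; assumption.
Qed.

End Chart.

(** * Diagonal binets *)

Definition diagonal_part (par : Z -> Z -> Prop) (r : net) : net :=
  Net (fun p q => dom r (p + q) (p - q) /\ par (p + q)%Z (p - q)%Z)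
      (fun p q => pos r (p + q) (p - q)).

Lemma diagonal_part_pair (r : net) :
  diagonal_pair r (diagonal_part primal r) (diagonal_part dual r).
Proof.
split; [| split].
- intros p q [_ [[a Ha] [b Hb]]]; simpl.
  destruct (Z.Even_or_Odd p) as [Hp | Hp]; [left | right];
    (split; [exact Hp |]); destruct Hp as [m Hm].
  + exists (a - m)%Z; lia.
  + exists (a - m - 1)%Z; lia.
- intros p q [_ [[a Ha] [b Hb]]]; simpl.
  destruct (Z.Even_or_Odd p) as [Hp | Hp]; [left | right];
    (split; [exact Hp |]); destruct Hp as [m Hm].
  + exists (a - m)%Z; lia.
  + exists (a - m - 1)%Z; lia.
- split; [| split; [| split]]; intros p q; reflexivity.
Qed.

Lemma union_diagonal_parts (r : net) (p q : Z) :
  is_binet r ->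
  let u := union_net (diagonal_part primal r) (diagonal_part dual r) in
  (dom u p q <-> dom (in_diagonal r) p q) /\
  pos u p q = pos (in_diagonal r) p q.
Proof.
intros Hb; simpl; split.
- specialize (Hb (p + q)%Z (p - q)%Z); tauto.
- destruct (Z.even (p + q)); reflexivity.
Qed.

(** * The deformation *)

(** The members of the deformation are affine images of the original binet
    under scalings of x and z that keep y. *)
Definition stretch (a c : R) (p : R3) : R3 := (a * px p, py p, c * pz p).

(** The original ellipsoid is the member t = 1; at t = beta / (beta - gamma)
    the semi-axis in direction z collapses. *)
Definition deformed_alpha (alpha beta t : R) : R := beta + (alpha - beta) * t.
Definition deformed_gamma (beta gamma t : R) : R := beta - (beta - gamma) * t.

Definition deformed_net (alpha beta gamma : R) (r : net) (t : R) : net :=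
  Net (dom r)
      (fun k l => stretch (sqrt (deformed_alpha alpha beta t / alpha))
                          (sqrt (deformed_gamma beta gamma t / gamma)) (pos r k l)).

Lemma eq_of_pow2 (x y : R) : 0 <= x -> 0 <= y -> x ^ 2 = y ^ 2 -> x = y.
Proof. intros; apply Rsqr_inj; auto; unfold Rsqr; lra. Qed.

Lemma continuous_triple (x y z : R -> R) (t : R) :
  continuous x t -> continuous y t -> continuous z t ->
  continuous (fun s => (x s, y s, z s) : R3) t.
Proof.
intros Hx Hy Hz; apply filterlim_locally; intros eps.
apply filterlim_locally with (eps := eps) in Hx.
apply filterlim_locally with (eps := eps) in Hy.
apply filterlim_locally with (eps := eps) in Hz.
generalize (filter_and _ _ (filter_and _ _ Hx Hy) Hz).
apply filter_imp; intros s [[Bx By] Bz].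
split; [split |]; assumption.
Qed.

(** The difference of two vertices is a combination of (A, 0, - C) and of the
    y direction.  Since (A, - C) and (A', - C') have the same length, a
    rotation about the y direction, of cosine [co] and sine [si], takes one
    direction to the other, and a translation adjusts the planes. *)
Lemma congruent_sections (cv cv' : curve) (A C A' C' S : R) (u y : Z -> R) :
  A ^ 2 + C ^ 2 <> 0 -> A ^ 2 + C ^ 2 = A' ^ 2 + C' ^ 2 ->
  (forall k, cdom cv k <-> cdom cv' k) ->
  (forall k, cdom cv k ->
     cpos cv k = (A * ((S + u k) / 2), y k, C * ((S - u k) / 2))) ->
  (forall k, cdom cv k ->
     cpos cv' k = (A' * ((S + u k) / 2), y k, C' * ((S - u k) / 2))) ->
  congruent cv cv'.
Proof.
intros HL HLL Hdom Hcv Hcv'; split; [exact Hdom |].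
set (L := A ^ 2 + C ^ 2) in *.
set (co := (A * A' + C * C') / L); set (si := (A' * C - A * C') / L).
assert (Hu : co ^ 2 + si ^ 2 = 1).
{ transitivity (L * (A' ^ 2 + C' ^ 2) / L ^ 2);
    [unfold co, si, L; field; exact HL | rewrite <- HLL; field; exact HL]. }
set (tx := A' * S / 2 - (co * (A * S / 2) - si * (C * S / 2))).
set (tz := C' * S / 2 - (si * (A * S / 2) + co * (C * S / 2))).
exists (fun v => (co * px v - si * pz v + tx, py v, si * px v + co * pz v + tz)).
split.
- intros v w; unfold dist3; f_equal.
  unfold dot3, sub3, px, py, pz; destruct v as [[a b] c], w as [[d e] f].
  simpl fst; simpl snd.
  transitivity ((co ^ 2 + si ^ 2) * ((a - d) ^ 2 + (c - f) ^ 2) + (b - e) ^ 2);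
    [ring | rewrite Hu; ring].
- intros k Hk; rewrite (Hcv k Hk), (Hcv' k Hk).
  unfold px, py, pz; simpl fst; simpl snd.
  assert (E1 : co * A + si * C = A').
  { unfold co, si; transitivity (A' * L / L);
      [unfold L; field; exact HL | field; exact HL]. }
  assert (E2 : si * A - co * C = - C').
  { unfold co, si; transitivity (- C' * L / L);
      [unfold L; field; exact HL | field; exact HL]. }
  f_equal; [f_equal |]; unfold tx, tz.
  + rewrite <- E1; field.
  + replace C' with (- (si * A - co * C)) by lra; field.
Qed.

Section Deformation.

Variables (alpha beta gamma delta : R) (r : net) (g1 g2 : Z -> R).
Hypothesis adm : admissible alpha beta gamma delta.
Hypothesis Hbin : is_binet r.
Hypothesis Hg1 : forall k, range1 r k -> range1 r (k + 1) ->
  g1 k <> 0 /\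
  g1 (k + 1)%Z = (alpha - beta - dsq (ell_f1 alpha gamma delta) k) / g1 k.
Hypothesis Hg2 : forall l, range2 r l -> range2 r (l + 1) ->
  g2 l <> 0 /\
  g2 (l + 1)%Z = (dsq (ell_f2 alpha gamma delta) l - alpha + beta) / g2 l.
Hypothesis Hpos : forall k l, dom r k l ->
  pos r k l = ell_point alpha beta gamma delta g1 g2 k l.

Let Hab : alpha > beta. Proof. apply adm. Qed.
Let Hbc : beta > gamma. Proof. apply adm. Qed.
Let Hc : gamma > 0. Proof. apply adm. Qed.
Let Hd : 0 < delta < PI. Proof. apply adm. Qed.
Let Hcos : 0 < cos (delta / 2). Proof. apply cos_half_pos, adm. Qed.

Let al := deformed_alpha alpha beta.
Let ga := deformed_gamma beta gamma.
Let hi := beta / (beta - gamma).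
Let rt := deformed_net alpha beta gamma r.

Let al_pos t : 0 < t < hi -> 0 < al t.
Proof. intros Ht; unfold al, deformed_alpha; nra. Qed.

Let ga_pos t : 0 < t < hi -> 0 < ga t.
Proof.
intros [_ Ht]; unfold ga, deformed_gamma, hi in *.
apply Rmult_lt_compat_r with (r := beta - gamma) in Ht; [| lra].
unfold Rdiv in Ht; rewrite Rmult_assoc, Rinv_l in Ht; lra.
Qed.

Lemma deformed_admissible t : 0 < t < hi -> admissible (al t) beta (ga t) delta.
Proof.
intros Ht; pose proof (ga_pos t Ht).
assert (0 < (alpha - beta) * t) by (apply Rmult_lt_0_compat; lra).
assert (0 < (beta - gamma) * t) by (apply Rmult_lt_0_compat; lra).
repeat split; try apply Hd; try assumption;
  unfold al, ga, deformed_alpha, deformed_gamma; lra.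
Qed.

Lemma deformed_differences t :
  al t - beta = (alpha - beta) * t /\ beta - ga t = (beta - gamma) * t /\
  al t - ga t = (alpha - gamma) * t.
Proof. unfold al, ga, deformed_alpha, deformed_gamma; repeat split; ring. Qed.

Lemma one_lt_hi : 1 < hi.
Proof.
unfold hi; apply Rmult_lt_reg_r with (beta - gamma); [lra |].
unfold Rdiv; rewrite Rmult_assoc, Rinv_l; lra.
Qed.

Lemma deformed_axis1 t : 0 < t < hi ->
  sqrt (al t / alpha) * axis1 alpha beta gamma delta
  = axis1 (al t) beta (ga t) delta.
Proof.
intros Ht; pose proof (al_pos t Ht) as Hat.
pose proof (deformed_admissible t Ht) as At.
apply eq_of_pow2.
- apply Rmult_le_pos; [apply sqrt_pos | apply Rlt_le, axis1_pos, adm].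
- apply Rlt_le, axis1_pos, At.
- rewrite Rpow_mult_distr, !axis1_sqr, pow2_sqrt by
    (auto; apply Rlt_le, Rdiv_lt_0_compat; lra).
  destruct (deformed_differences t) as (-> & _ & ->); field; repeat split; lra.
Qed.

Lemma deformed_axis3 t : 0 < t < hi ->
  sqrt (ga t / gamma) * axis3 alpha beta gamma delta
  = axis3 (al t) beta (ga t) delta.
Proof.
intros Ht; pose proof (ga_pos t Ht) as Hgt.
pose proof (deformed_admissible t Ht) as At.
apply eq_of_pow2.
- apply Rmult_le_pos; [apply sqrt_pos | apply Rlt_le, axis3_pos, adm].
- apply Rlt_le, axis3_pos, At.
- rewrite Rpow_mult_distr, !axis3_sqr, pow2_sqrt by
    (auto; apply Rlt_le, Rdiv_lt_0_compat; lra).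
  destruct (deformed_differences t) as (_ & -> & ->); field; repeat split; lra.
Qed.

(** Both profiles are multiplied by sqrt t, so the y coordinate is unchanged
    exactly when the coefficient of y is divided by t. *)
Lemma deformed_axis2 t : 0 < t < hi ->
  axis2 alpha beta gamma = axis2 (al t) beta (ga t) * t.
Proof.
intros Ht.
pose proof (deformed_admissible t Ht) as At.
apply eq_of_pow2.
- apply Rlt_le, (axis2_pos _ _ _ delta), adm.
- apply Rmult_le_pos; [apply Rlt_le, (axis2_pos _ _ _ delta), At | lra].
- rewrite Rpow_mult_distr, !(axis2_sqr _ _ _ delta) by auto.
  destruct (deformed_differences t) as (-> & -> & _); field; repeat split; lra.
Qed.

Lemma deformed_net_pos t k l : 0 < t < hi -> dom r k l ->
  pos (rt t) k l
  = (axis1 (al t) beta (ga t) delta * (sn delta k * cs delta l),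
     axis2 alpha beta gamma * g1 k * g2 l,
     axis3 (al t) beta (ga t) delta * (cs delta k * sn delta l)).
Proof.
intros Ht Hkl; simpl.
rewrite (Hpos _ _ Hkl), <- deformed_axis1, <- deformed_axis3 by assumption.
unfold stretch, ell_point, px, py, pz; simpl fst; simpl snd.
fold al ga; f_equal; [f_equal |]; ring.
Qed.

Lemma sqrt_f_scale t : 0 < t < hi ->
  sqrt ((al t - ga t) / cos (delta / 2)) ^ 2
  = t * sqrt ((alpha - gamma) / cos (delta / 2)) ^ 2.
Proof.
intros Ht; pose proof (deformed_admissible t Ht) as (H1 & H2 & _).
rewrite !pow2_sqrt by (apply Rlt_le, Rdiv_lt_0_compat; lra).
unfold al, ga, deformed_alpha, deformed_gamma; field; lra.
Qed.

Lemma deformed_net_ellipsoid t : 0 < t < hi ->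
  discrete_ellipsoid (al t) beta (ga t) delta (rt t).
Proof.
intros Ht; pose proof (sqrt_f_scale t Ht) as Hs.
assert (Hst : sqrt t <> 0) by (apply Rgt_not_eq, sqrt_lt_R0, Ht).
assert (Hst2 : sqrt t ^ 2 = t) by (apply pow2_sqrt; lra).
split; [exact Hbin |].
exists (fun k => sqrt t * g1 k), (fun l => sqrt t * g2 l); split; [| split].
- intros k Hk Hk1; destruct (Hg1 k Hk Hk1) as [Hn ->].
  split; [apply Rmult_integral_contrapositive_currified; assumption |].
  replace (al t - beta - dsq (ell_f1 (al t) (ga t) delta) k)
    with (sqrt t ^ 2 * (alpha - beta - dsq (ell_f1 alpha gamma delta) k)).
  { field; split; assumption. }
  unfold dsq, ell_f1; rewrite Hst2.
  transitivity (al t - beta - t * sqrt ((alpha - gamma) / cos (delta / 2)) ^ 2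
                * (sin (delta * half k) * sin (delta * half (k + 1)))).
  { unfold al, deformed_alpha; ring. }
  rewrite <- Hs; ring.
- intros l Hl Hl1; destruct (Hg2 l Hl Hl1) as [Hn ->].
  split; [apply Rmult_integral_contrapositive_currified; assumption |].
  replace (dsq (ell_f2 (al t) (ga t) delta) l - al t + beta)
    with (sqrt t ^ 2 * (dsq (ell_f2 alpha gamma delta) l - alpha + beta)).
  { field; split; assumption. }
  unfold dsq, ell_f2; rewrite Hst2.
  transitivity (t * sqrt ((alpha - gamma) / cos (delta / 2)) ^ 2
                * (cos (delta * half l) * cos (delta * half (l + 1)))
                - al t + beta).
  { unfold al, deformed_alpha; ring. }
  rewrite <- Hs; ring.
- intros k l Hkl; rewrite (deformed_net_pos t k l Ht Hkl).
  fold (axis1 (al t) beta (ga t) delta) (axis2 (al t) beta (ga t))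
    (axis3 (al t) beta (ga t) delta) (sn delta k) (cs delta k) (sn delta l)
    (cs delta l).
  f_equal; [f_equal |]; [ring | | ring].
  transitivity (axis2 (al t) beta (ga t) * sqrt t ^ 2 * g1 k * g2 l); [| ring].
  rewrite Hst2, <- deformed_axis2 by exact Ht; reflexivity.
Qed.

Lemma deformed_net_start : al 1 = alpha /\ ga 1 = gamma /\ same_net (rt 1) r.
Proof.
assert (Ea : al 1 = alpha) by (unfold al, deformed_alpha; ring).
assert (Eg : ga 1 = gamma) by (unfold ga, deformed_gamma; ring).
split; [exact Ea | split; [exact Eg | split; [reflexivity |]]].
intros k l _; simpl; fold al ga; rewrite Ea, Eg.
unfold Rdiv; rewrite !Rinv_r, sqrt_1 by lra.
unfold stretch, px, py, pz; destruct (pos r k l) as [[x y] z]; simpl.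
f_equal; [f_equal |]; ring.
Qed.

Lemma deformed_net_continuous :
  continuous_family 0 hi al (fun _ => beta) ga (fun _ => delta) rt.
Proof.
intros t Ht; pose proof (al_pos t Ht); pose proof (ga_pos t Ht).
assert (Ca : continuous al t).
{ apply (ex_derive_continuous (V := R_NormedModule)).
  unfold al, deformed_alpha; auto_derive; auto. }
assert (Cg : continuous ga t).
{ apply (ex_derive_continuous (V := R_NormedModule)).
  unfold ga, deformed_gamma; auto_derive; auto. }
repeat split; auto; try apply continuous_const.
intros k l _; simpl; unfold stretch; apply continuous_triple.
- apply (ex_derive_continuous (V := R_NormedModule)).
  unfold deformed_alpha; auto_derive.
  apply Rdiv_lt_0_compat; [assumption | lra].
- apply continuous_const.
- apply (ex_derive_continuous (V := R_NormedModule)).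
  unfold deformed_gamma; auto_derive.
  apply Rdiv_lt_0_compat; [assumption | lra].
Qed.

Lemma sqrt_quotient_inj (a b c x : R) :
  0 < a -> 0 < b -> 0 < c -> x <> 0 ->
  sqrt (a / c) * x = sqrt (b / c) * x -> a = b.
Proof.
intros Ha Hb Hc' Hx E.
apply Rmult_eq_reg_r in E; [| exact Hx].
apply sqrt_inj in E; try (apply Rlt_le, Rdiv_lt_0_compat; assumption).
unfold Rdiv in E; apply Rmult_eq_reg_r in E; [exact E |].
apply Rinv_neq_0_compat; lra.
Qed.

Lemma deformed_net_nonconstant :
  nonconstant_family 0 hi al (fun _ => beta) ga (fun _ => delta) rt.
Proof.
intros t t' Ht Ht' Hne.
assert (Na : al t <> al t').
{ unfold al, deformed_alpha; intros E; apply Hne.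
  apply Rmult_eq_reg_l with (alpha - beta); lra. }
assert (Ng : ga t <> ga t').
{ unfold ga, deformed_gamma; intros E; apply Hne.
  apply Rmult_eq_reg_l with (beta - gamma); lra. }
split.
- intros E; injection E; intros; contradiction.
- intros k l _; simpl; fold al ga; unfold stretch, px, py, pz; simpl fst; simpl snd.
  intros Hxz E; injection E; intros Ez Ex.
  destruct Hxz as [Hx | Hz].
  + apply Na; revert Ex; apply sqrt_quotient_inj; auto; try lra.
    intros E0; apply Hx; rewrite E0; ring.
  + apply Ng; revert Ez; apply sqrt_quotient_inj; auto; try lra.
    intros E0; apply Hz; rewrite E0; ring.
Qed.

(** The length of the vector (A, - C) is an invariant of the deformation, as
    is required for the sections to stay congruent. *)
Lemma deformed_axes_sqr_sum t : 0 < t < hi ->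
  axis1 (al t) beta (ga t) delta ^ 2 + axis3 (al t) beta (ga t) delta ^ 2
  = beta * (alpha - gamma) ^ 2 / ((alpha - beta) * (beta - gamma))
    / cos (delta / 2) ^ 2.
Proof.
intros Ht; pose proof (deformed_admissible t Ht).
rewrite axis1_sqr, axis3_sqr by assumption.
assert (E : al t * (beta - gamma) + ga t * (alpha - beta) = beta * (alpha - gamma)).
{ unfold al, ga, deformed_alpha, deformed_gamma; ring. }
destruct (deformed_differences t) as (-> & -> & ->).
transitivity ((al t * (beta - gamma) + ga t * (alpha - beta)) * (alpha - gamma)
              / ((alpha - beta) * (beta - gamma)) / cos (delta / 2) ^ 2);
  [| rewrite E]; field; repeat split; lra.
Qed.

Lemma deformed_axes_neq0 t : 0 < t < hi ->
  axis1 (al t) beta (ga t) delta ^ 2 + axis3 (al t) beta (ga t) delta ^ 2 <> 0.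
Proof.
intros Ht; pose proof (axis1_pos _ _ _ _ (deformed_admissible t Ht)).
pose proof (axis3_pos _ _ _ _ (deformed_admissible t Ht)); nra.
Qed.

Lemma deformed_congruent_plus t t' p : 0 < t < hi -> 0 < t' < hi ->
  congruent (polygon_plus (rt t) p) (polygon_plus (rt t') p).
Proof.
intros Ht Ht'.
apply congruent_sections with
  (A := axis1 (al t) beta (ga t) delta) (C := axis3 (al t) beta (ga t) delta)
  (A' := axis1 (al t') beta (ga t') delta) (C' := axis3 (al t') beta (ga t') delta)
  (S := sin (delta * IZR p)) (u := fun q => sin (delta * IZR q))
  (y := fun q => axis2 alpha beta gamma * g1 (p + q)%Z * g2 (p - q)%Z).
- apply deformed_axes_neq0, Ht.
- rewrite !deformed_axes_sqr_sum by assumption; reflexivity.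
- reflexivity.
- intros q Hq; rewrite <- sn_cs_diagonal, <- cs_sn_diagonal.
  apply deformed_net_pos; assumption.
- intros q Hq; rewrite <- sn_cs_diagonal, <- cs_sn_diagonal.
  apply deformed_net_pos; assumption.
Qed.

(** The other family is the mirror image: replace C by - C and exchange the
    roles of n_+ and n_-. *)
Lemma deformed_congruent_minus t t' q : 0 < t < hi -> 0 < t' < hi ->
  congruent (polygon_minus (rt t) q) (polygon_minus (rt t') q).
Proof.
intros Ht Ht'.
assert (W : forall s p, 0 < s < hi -> dom r (p + q) (p - q) ->
  cpos (polygon_minus (rt s) q) p =
  (axis1 (al s) beta (ga s) delta
     * ((sin (delta * IZR q) + sin (delta * IZR p)) / 2),
   axis2 alpha beta gamma * g1 (p + q)%Z * g2 (p - q)%Z,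
   - axis3 (al s) beta (ga s) delta
     * ((sin (delta * IZR q) - sin (delta * IZR p)) / 2))).
{ intros s p Hs Hp.
  transitivity (pos (rt s) (p + q) (p - q)); [reflexivity |].
  rewrite deformed_net_pos, sn_cs_diagonal, cs_sn_diagonal by assumption.
  f_equal; [f_equal |]; lra. }
apply congruent_sections with
  (A := axis1 (al t) beta (ga t) delta) (C := - axis3 (al t) beta (ga t) delta)
  (A' := axis1 (al t') beta (ga t') delta) (C' := - axis3 (al t') beta (ga t') delta)
  (S := sin (delta * IZR q)) (u := fun p => sin (delta * IZR p))
  (y := fun p => axis2 alpha beta gamma * g1 (p + q)%Z * g2 (p - q)%Z).
- replace ((- axis3 (al t) beta (ga t) delta) ^ 2)
    with (axis3 (al t) beta (ga t) delta ^ 2) by ring.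
  apply deformed_axes_neq0, Ht.
- transitivity (axis1 (al t) beta (ga t) delta ^ 2
                + axis3 (al t) beta (ga t) delta ^ 2); [ring |].
  rewrite deformed_axes_sqr_sum, <- (deformed_axes_sqr_sum t') by assumption; ring.
- reflexivity.
- intros p Hp; apply W; assumption.
- intros p Hp; apply W; assumption.
Qed.

(** The system with a = alpha, b = beta, c = gamma.  The squares of f3, g3,
    h3 are the squared semi-axes of the member of parameter s divided by s:
    this makes their differences independent of s. *)
Definition deformed_confocal : confocal_data :=
  let F := sqrt ((alpha - gamma) / cos (delta / 2)) in
  ConfocalData alpha beta gamma
    (ell_f1 alpha gamma delta) g1 (fun k => F * cs delta k)
    (ell_f2 alpha gamma delta) g2 (fun l => F * sn delta l)
    (fun s => sqrt (al s / s)) (fun s => sqrt (beta / s))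
    (fun s => sqrt (ga s / s)).

Lemma deformed_confocal_system t : confocal_system (rt t) 0 hi deformed_confocal.
Proof.
assert (HF : sqrt ((alpha - gamma) / cos (delta / 2)) ^ 2
             = (alpha - gamma) / cos (delta / 2)).
{ apply pow2_sqrt, Rlt_le, Rdiv_lt_0_compat; lra. }
assert (W : forall k, sqrt ((alpha - gamma) / cos (delta / 2)) ^ 2
   * (cs delta k * cs delta (k + 1) + sn delta k * sn delta (k + 1))
   = alpha - gamma).
{ intros k; rewrite HF, adjacent_cos by (left; reflexivity); field; lra. }
split; [exact Hab | split; [exact Hbc | split; [| split]]].
- intros k Hk Hk1; simpl; destruct (Hg1 k Hk Hk1) as [Hn Hs]; split.
  + unfold dsq at 2; rewrite Hs; field; exact Hn.
  + etransitivity; [| exact (W k)]; unfold dsq, ell_f1, sn; ring.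
- intros l Hl Hl1; simpl; destruct (Hg2 l Hl Hl1) as [Hn Hs]; split.
  + unfold dsq at 2; rewrite Hs; field; exact Hn.
  + etransitivity; [| exact (W l)]; unfold dsq, ell_f2, cs; ring.
- intros s Hs; simpl cf3; simpl cg3; simpl ch3; simpl ca; simpl cb; simpl cc.
  pose proof (al_pos s Hs) as Has; pose proof (ga_pos s Hs) as Hgs.
  rewrite !pow2_sqrt by (apply Rlt_le, Rdiv_lt_0_compat; lra).
  repeat split.
  + unfold al, deformed_alpha; field; lra.
  + unfold al, ga, deformed_alpha, deformed_gamma; field; lra.
  + apply (ex_derive_continuous (V := R_NormedModule)).
    unfold al, deformed_alpha; auto_derive; repeat split; try lra.
    apply Rdiv_lt_0_compat; [assumption | lra].
  + apply (ex_derive_continuous (V := R_NormedModule)).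
    auto_derive; repeat split; try lra.
    apply Rdiv_lt_0_compat; lra.
  + apply (ex_derive_continuous (V := R_NormedModule)).
    unfold ga, deformed_gamma; auto_derive; repeat split; try lra.
    apply Rdiv_lt_0_compat; [assumption | lra].
Qed.

Lemma deformed_confocal_pos t k l : 0 < t < hi -> dom r k l ->
  pos (rt t) k l = scal3 (sqrt t) (confocal_map deformed_confocal k l t).
Proof.
intros Ht Hkl; rewrite (deformed_net_pos t k l Ht Hkl).
pose proof (al_pos t Ht) as Hat; pose proof (ga_pos t Ht) as Hgt.
pose proof (deformed_admissible t Ht) as At.
assert (HF : 0 < (alpha - gamma) / cos (delta / 2))
  by (apply Rdiv_lt_0_compat; lra).
assert (Pab : 0 < (alpha - beta) * (alpha - gamma))
  by (apply Rmult_lt_0_compat; lra).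
assert (Pabc : 0 < (alpha - beta) * (beta - gamma))
  by (apply Rmult_lt_0_compat; lra).
assert (Pac : 0 < (alpha - gamma) * (beta - gamma))
  by (apply Rmult_lt_0_compat; lra).
(* both sides are positive, so it suffices to compare squares *)
assert (E1 : axis1 (al t) beta (ga t) delta =
   sqrt t * (sqrt ((alpha - gamma) / cos (delta / 2)) ^ 2 * sqrt (al t / t)
             / sqrt ((alpha - beta) * (alpha - gamma)))).
{ rewrite pow2_sqrt by lra; apply eq_of_pow2.
  - apply Rlt_le, axis1_pos, At.
  - apply Rmult_le_pos; [apply sqrt_pos |].
    apply Rdiv_le_0_compat; [| apply sqrt_lt_R0; exact Pab].
    apply Rmult_le_pos; [lra | apply sqrt_pos].
  - rewrite axis1_sqr by exact At.
    unfold Rdiv at 4; rewrite !Rpow_mult_distr, pow_inv, !pow2_sqrt; try lra.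
    + destruct (deformed_differences t) as (-> & _ & ->); field; repeat split; lra.
    + apply Rlt_le, Rdiv_lt_0_compat; lra. }
assert (E2 : axis2 alpha beta gamma =
   sqrt t * (sqrt (beta / t) / sqrt ((alpha - beta) * (beta - gamma)))).
{ apply eq_of_pow2.
  - apply Rlt_le, (axis2_pos _ _ _ delta), adm.
  - apply Rmult_le_pos; [apply sqrt_pos |].
    apply Rdiv_le_0_compat; [apply sqrt_pos | apply sqrt_lt_R0; exact Pabc].
  - rewrite (axis2_sqr _ _ _ delta) by exact adm.
    unfold Rdiv at 2; rewrite !Rpow_mult_distr, pow_inv, !pow2_sqrt; try lra.
    + field; repeat split; lra.
    + apply Rlt_le, Rdiv_lt_0_compat; lra. }
assert (E3 : axis3 (al t) beta (ga t) delta =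
   sqrt t * (sqrt ((alpha - gamma) / cos (delta / 2)) ^ 2 * sqrt (ga t / t)
             / sqrt ((alpha - gamma) * (beta - gamma)))).
{ rewrite pow2_sqrt by lra; apply eq_of_pow2.
  - apply Rlt_le, axis3_pos, At.
  - apply Rmult_le_pos; [apply sqrt_pos |].
    apply Rdiv_le_0_compat; [| apply sqrt_lt_R0; exact Pac].
    apply Rmult_le_pos; [lra | apply sqrt_pos].
  - rewrite axis3_sqr by exact At.
    unfold Rdiv at 4; rewrite !Rpow_mult_distr, pow_inv, !pow2_sqrt; try lra.
    + destruct (deformed_differences t) as (_ & -> & ->); field; repeat split; lra.
    + apply Rlt_le, Rdiv_lt_0_compat; lra. }
rewrite E1, E2, E3.
unfold scal3, confocal_map, px, py, pz; simpl fst; simpl snd.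
unfold deformed_confocal; simpl; unfold ell_f1, ell_f2.
fold (sn delta k) (cs delta l).
unfold Rdiv; f_equal; [f_equal |]; ring.
Qed.

Lemma deformed_net_confocal t t' : 0 < t < hi -> 0 < t' < hi ->
  confocal_up_to_scaling (rt t) (rt t').
Proof.
intros Ht Ht'; split; [reflexivity |].
exists 0, hi, t, t', deformed_confocal, (sqrt t), (sqrt t').
split; [apply deformed_confocal_system |].
split; [exact Ht | split; [exact Ht' |]].
split; [apply sqrt_lt_R0, Ht | split; [apply sqrt_lt_R0, Ht' |]].
intros k l Hkl; split; apply deformed_confocal_pos; assumption.
Qed.

End Deformation.

Theorem theorem5p6
  (alpha beta gamma delta : R) (r : net)
  (Hab : alpha > beta) (Hbc : beta > gamma) (Hc : gamma > 0)
  (Hd : 0 < delta < PI)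
  (Hr : discrete_ellipsoid alpha beta gamma delta r) :
  (* (i) *)
  (exists Pp Pm : Z -> plane,
     (forall p p', parallel (Pp p) (Pp p')) /\
     (forall q q', parallel (Pm q) (Pm q')) /\
     (forall p, exists M rho,
        conjugate_polygon (Pp p) M rho (polygon_plus r p)) /\
     (forall q, exists M rho,
        conjugate_polygon (Pm q) M rho (polygon_minus r q)) /\
     (forall p, real_section delta p ->
        discrete_circle_in (Pp p) (polygon_plus r p)) /\
     (forall q, real_section delta q ->
        discrete_circle_in (Pm q) (polygon_minus r q)))
  /\
  (* (ii); the common point is at infinity if the plane of the polygon
     passes through the centre of the ellipsoid *)
  (exists Box : Z -> Z -> plane,
     is_Box r Box /\
     (forall p, exists (v : R3) (w : R),
        (v <> zero3 \/ w <> 0) /\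
        (sin (delta * IZR p) <> 0 -> w <> 0) /\
        forall q, cdom (polygon_plus r p) q ->
          quad_in_dom r (p + q) (p - q) ->
          on_plane_proj (Box (p + q)%Z (p - q)%Z) v w) /\
     (forall q, exists (v : R3) (w : R),
        (v <> zero3 \/ w <> 0) /\
        (sin (delta * IZR q) <> 0 -> w <> 0) /\
        forall p, cdom (polygon_minus r q) p ->
          quad_in_dom r (p + q) (p - q) ->
          on_plane_proj (Box (p + q)%Z (p - q)%Z) v w))
  /\
  (* (iii) *)
  (principal r /\
   exists b b' : net,
     diagonal_pair r b b' /\
     (forall p, same_curve (line1 (union_net b b') p) (polygon_plus r p)) /\
     (forall q, same_curve (line2 (union_net b b') q) (polygon_minus r q)) /\
     (forall p, real_section delta p ->
        discrete_circle (line1 (union_net b b') p)) /\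
     (forall q, real_section delta q ->
        discrete_circle (line2 (union_net b b') q)))
  /\
  (* (iv) *)
  (exists (lo hi t0 : R) (al be ga de : R -> R) (rt : R -> net),
     lo < t0 < hi /\
     same_net (rt t0) r /\
     al t0 = alpha /\ be t0 = beta /\ ga t0 = gamma /\ de t0 = delta /\
     ellipsoid_family lo hi al be ga de rt /\
     continuous_family lo hi al be ga de rt /\
     nonconstant_family lo hi al be ga de rt /\
     (forall t, lo < t < hi ->
        (forall p, real_section delta p ->
           discrete_circle (polygon_plus (rt t) p)) /\
        (forall q, real_section delta q ->
           discrete_circle (polygon_minus (rt t) q))) /\
     (forall t t', lo < t < hi -> lo < t' < hi ->
        (forall p, congruent (polygon_plus (rt t) p) (polygon_plus (rt t') p)) /\
        (forall q, congruent (polygon_minus (rt t) q) (polygon_minus (rt t') q)) /\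
        confocal_up_to_scaling (rt t) (rt t'))).
Proof.
assert (adm : admissible alpha beta gamma delta) by (repeat split; tauto).
pose proof (admissible_ellipsoid_profiles _ _ _ _ _ adm Hr)
  as (g1 & g2 & Hprof & Hpos).
pose proof (sections_in_parallel_planes _ _ _ _ _ _ _ adm Hprof Hpos) as Hi.
split; [exact Hi |].
split; [exact (section_planes_concurrent _ _ _ _ _ _ _ adm Hprof Hpos) |].
split.
- pose proof (proj1 Hr) as Hbin.
  split; [exact (ellipsoid_principal _ _ _ _ _ _ _ adm Hprof Hpos Hbin) |].
  assert (S1 : forall p, same_curve
    (line1 (union_net (diagonal_part primal r) (diagonal_part dual r)) p)
    (polygon_plus r p)).
  { intros p; split; intros q; [| intros _]; apply union_diagonal_parts, Hbin. }
  assert (S2 : forall q, same_curve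
    (line2 (union_net (diagonal_part primal r) (diagonal_part dual r)) q)
    (polygon_minus r q)).
  { intros q; split; intros p; [| intros _]; apply union_diagonal_parts, Hbin. }
  destruct Hi as (Pp & Pm & _ & _ & _ & _ & Cp & Cm).
  exists (diagonal_part primal r), (diagonal_part dual r).
  split; [apply diagonal_part_pair | split; [exact S1 | split; [exact S2 | split]]].
  + intros p Hp; apply same_curve_circle with (1 := S1 p).
    exists (Pp p); apply Cp, Hp.
  + intros q Hq; apply same_curve_circle with (1 := S2 q).
    exists (Pm q); apply Cm, Hq.
- clear g1 g2 Hprof Hpos Hi.
  destruct Hr as (Hbin & g1 & g2 & Hg1 & Hg2 & Hpos).
  destruct (deformed_net_start alpha beta gamma delta r adm) as (Ea & Eg & Esame).
  exists 0, (beta / (beta - gamma)), 1.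
  exists (deformed_alpha alpha beta), (fun _ => beta), (deformed_gamma beta gamma),
    (fun _ => delta), (deformed_net alpha beta gamma r).
  assert (Hell := deformed_net_ellipsoid _ _ _ _ _ _ _ adm Hbin Hg1 Hg2 Hpos).
  assert (Hadm := deformed_admissible _ _ _ _ adm).
  split; [split; [lra | exact (one_lt_hi _ _ _ _ adm)] |].
  split; [exact Esame |].
  split; [exact Ea | split; [reflexivity | split; [exact Eg | split; [reflexivity |]]]].
  split.
  { split; [| reflexivity].
    intros t Ht; split; [apply Hadm, Ht | apply Hell, Ht]. }
  split; [exact (deformed_net_continuous _ _ _ _ r adm) |].
  split; [exact (deformed_net_nonconstant _ _ _ _ r adm) |].
  split.
  + intros t Ht.
    destruct (admissible_ellipsoid_profiles _ _ _ _ _ (Hadm t Ht) (Hell t Ht))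
      as (h1 & h2 & Hh & Hpt).
    destruct (sections_in_parallel_planes _ _ _ _ _ _ _ (Hadm t Ht) Hh Hpt)
      as (Pp & Pm & _ & _ & _ & _ & Cp & Cm).
    split; intros j Hj; [exists (Pp j) | exists (Pm j)]; auto.
  + intros t t' Ht Ht'; split; [| split].
    * intros p.
      exact (deformed_congruent_plus _ _ _ _ _ _ _ adm Hpos t t' p Ht Ht').
    * intros q.
      exact (deformed_congruent_minus _ _ _ _ _ _ _ adm Hpos t t' q Ht Ht').
    * exact (deformed_net_confocal _ _ _ _ _ _ _ adm Hg1 Hg2 Hpos t t' Ht Ht').
Qed.
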